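(* Let $\mathfrak{g}$ be a $12$-dimensional filiform Lie algebra over a field $k$ of characteristic zero with law $\lambda=(\alpha_{k,s})\in\mathcal{A}_{12}^2$ such that $200\,\alpha_{3,8}-27\,\alpha_{2,6}\neq 0$. Then $\mathfrak{g}$ is symplectic and characteristically nilpotent.
   Context: For a Lie algebra $\mathfrak{g}$ put $\mathfrak{g}^0=\mathfrak{g}$, $\mathfrak{g}^j=[\mathfrak{g}^{j-1},\mathfrak{g}]$. A nilpotent Lie algebra of dimension $n$ is filiform if $\mathfrak{g}^{n-1}=0$ and $\mathfrak{g}^{n-2}\neq 0$. A Lie algebra is symplectic if it admits a nondegenerate skew-symmetric bilinear form $\omega$ with $\omega([x,y],z)-\omega([x,z],y)+\omega([y,z],x)=0$ for all $x,y,z$. A Lie algebra is characteristically nilpotent (a CNLA) if all its derivations are nilpotent. Laws: let $\mathcal{I}_{12}=\{(k,s): 2\le k\le 6,\ 2k+1\le s\le 12\}\cup\{(6,12)\}$. Every filiform Lie algebra of dimension $12$ has an adapted basis $(e_1,\dots,e_{12})$, i.e. one in which the brackets are $[e_1,e_i]=e_{i+1}$ for $2\le i\le 11$, $[e_1,e_{12}]=0$, and $$[e_i,e_j]=\sum_{r=1}^{12}\Bigl(\sum_{\ell=0}^{\lfloor (j-i-1)/2\rfloor}(-1)^\ell\binom{j-i-\ell-1}{\ell}\alpha_{i+\ell,\,r-j+i+2\ell+1}\Bigr)e_r,\qquad 2\le i<j\le 12,$$ with constants $\alpha_{k,s}\in k$ that vanish for $(k,s)\notin\mathcal{I}_{12}$.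 $\mathcal{A}_{12}$ is the set of such laws (families $(\alpha_{k,s})$ for which the Jacobi identity holds). $\mathcal{A}_{12}^2$ is the set of laws in $\mathcal{A}_{12}$ whose algebras satisfy: (a) $\mathfrak{g}$ contains no one-codimensional subspace $U\supseteq\mathfrak{g}^1$ with $[U,\mathfrak{g}^1]\subseteq\mathfrak{g}^4$ (equivalently $\alpha_{2,5}\neq0$); (b) $\mathfrak{g}^{4}$ is abelian (equivalently $\alpha_{6,12}=0$); and which do not satisfy (c) $[\mathfrak{g}^1,\mathfrak{g}^1]\subseteq\mathfrak{g}^6$ (i.e. $\alpha_{3,7}\neq0$). *)

(* Defs.v *)
From HB Require Import structures.
From mathcomp Require Import all_boot all_order all_algebra.

Set Implicit Arguments.
Unset Strict Implicit.
Unset Printing Implicit Defensive.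

Import GRing.Theory.
Local Open Scope ring_scope.

Section LieAlgebras.
Variables (k : fieldType) (g : vectType k) (br : {bilinear g -> g -> g}).

Definition is_lie_bracket : Prop :=
  (forall x, br x x = 0) /\
  (forall x y z, br x (br y z) + br y (br z x) + br z (br x y) = 0).

(* [U, W] is the linear span of all brackets; by bilinearity, brackets of basis
   vectors suffice (compare prodv in falgebra). *)
Definition lie_prodv (U W : {vspace g}) : {vspace g} :=
  <<[seq br u w | u <- vbasis U, w <- vbasis W]>>%VS.

Definition lie_abelian (U : {vspace g}) : Prop :=
  {in U &, forall x y, br x y = 0}.

Fixpoint lcs (j : nat) : {vspace g} :=
  if j is j'.+1 then lie_prodv (lcs j') fullv else fullv.

Definition lie_nilpotent : Prop := exists j, lcs j = 0%VS.

Definition filiform : Prop :=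
  let n := \dim {:g} in
  [/\ lie_nilpotent, lcs (n - 1) = 0%VS & lcs (n - 2) <> 0%VS].

Definition symplectic : Prop :=
  exists2 omega : {skew_symmetric g}, nondegenerate omega &
    forall x y z,
      omega (br x y) z - omega (br x z) y + omega (br y z) x = 0.

Definition derivation (D : {linear g -> g}) : Prop :=
  forall x y, D (br x y) = br (D x) y + br x (D y).

Definition nilpotent_map (D : {linear g -> g}) : Prop :=
  exists m, forall x, iter m D x = 0.

Definition characteristically_nilpotent : Prop :=
  forall D : {linear g -> g}, derivation D -> nilpotent_map D.

Definition prop_a : Prop :=
  ~ exists U : {vspace g},
      [/\ (\dim U).+1 = \dim {:g}, (lcs 1 <= U)%VS
        & (lie_prodv U (lcs 1) <= lcs 4)%VS].

Definition prop_b : Prop := lie_abelian (lcs 4).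

Definition prop_c : Prop := (lie_prodv (lcs 1) (lcs 1) <= lcs 6)%VS.

End LieAlgebras.

Definition I12 (p : nat * nat) : bool :=
  let: (i, s) := p in
  [&& (2 <= i <= 6)%N & (2 * i + 1 <= s <= 12)%N] || (p == (6, 12)%N).

Section Laws.
Variables (k : fieldType) (alpha : nat -> nat -> k).

(* The coefficient of e_r in [e_i, e_j] for 2 <= i < j. The second index of
   alpha is r - j + i + 2l + 1; when this integer is negative the truncated
   subtraction gives 0, and (_, 0) also lies outside I12, where alpha is 0. *)
Definition law_coef (i j r : nat) : k :=
  \sum_(0 <= l < ((j - i - 1)./2).+1)
    (-1) ^+ l * 'C(j - i - l - 1, l)%:R * alpha (i + l) (r + i + 2 * l + 1 - j).

(* e is indexed from 1: only e 1, ..., e 12 are relevant. *)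
Definition adapted_basis (g : vectType k) (br : {bilinear g -> g -> g})
    (e : nat -> g) : Prop :=
  [/\ basis_of fullv [seq e i | i <- iota 1 12],
      forall i, (2 <= i <= 11)%N -> br (e 1%N) (e i) = e i.+1,
      br (e 1%N) (e 12%N) = 0
    & forall i j, (2 <= i)%N -> (i < j)%N -> (j <= 12)%N ->
        br (e i) (e j) = \sum_(1 <= r < 13) law_coef i j r *: e r].

(* Structure constants of the algebra of the law, for indices in 1..12. *)
Definition struct_const_lt (i j r : nat) : k :=
  if i == 1%N then (r == j.+1)%:R else law_coef i j r.

Definition struct_const (i j r : nat) : k :=
  if (i < j)%N then struct_const_lt i j r
  else if (j < i)%N then - struct_const_lt j i r else 0.

Definition law_bracket (x y : 'rV[k]_12) : 'rV[k]_12 :=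
  \row_(r < 12) \sum_(i < 12) \sum_(j < 12)
    x 0 i * y 0 j * struct_const i.+1 j.+1 r.+1.

Lemma law_bracket_is_bilinear :
  bilinear_for
    (GRing.Scale.Law.clone _ _ ( *:%R : k -> 'rV[k]_12 -> 'rV[k]_12) _)
    (GRing.Scale.Law.clone _ _ ( *:%R : k -> 'rV[k]_12 -> 'rV[k]_12) _)
    law_bracket.
Proof.
split=> [y | x] a u v; apply/rowP=> r; rewrite !mxE mulr_sumr -big_split /=;
  apply: eq_bigr => i _; rewrite mulr_sumr -big_split /=;
  apply: eq_bigr => j _; rewrite !mxE.
- by rewrite !mulrDl !mulrA.
- by rewrite mulrDr mulrDl !mulrA (mulrC (x 0 i)).
Qed.

HB.instance Definition _ :=
  bilinear_isBilinear.Build k 'rV[k]_12 'rV[k]_12 'rV[k]_12 *:%R *:%R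
    law_bracket law_bracket_is_bilinear.

Definition A12 : Prop :=
  (forall i s, ~~ I12 (i, s) -> alpha i s = 0) /\ is_lie_bracket law_bracket.

Definition A12_2 : Prop :=
  [/\ A12, prop_a law_bracket, prop_b law_bracket & ~ prop_c law_bracket].

End Laws.

(* Main.v *)
(* Idea. With [alpha i s] in weight s - 2i - 1, the bracket of an adapted law maps
   (e_i, e_j) to the span of the e_r with r >= i + j as soon as alpha_{6,12} = 0.
   In weight 0 the Jacobi identity forces alpha_{2,5}, alpha_{3,7}, alpha_{4,9},
   alpha_{5,11} to be 4620t, 462t, 66t, 11t with t != 0: up to higher weights the
   algebra is a truncation of the positive part of the Witt algebra.

   Symplectic form: the law extends to a law in dimension 13, and the coefficient
   of e_13 in the extended bracket is a 2-cocycle on g. It is nondegenerate since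
   it vanishes on (e_i, e_j) for i + j > 13 but not for i + j = 13.

   Derivations: the weight 0 part of a derivation D maps e_i to i s e_i, where s is
   the e_1-coordinate of D e_1. The weight 1 parts of D [e_2, e_3] and D [e_3, e_4]
   give (200 alpha_{3,8} - 27 alpha_{2,6}) s = 0, hence s = 0 and D is strictly
   triangular. *)
From HB Require Import structures.
From mathcomp Require Import all_boot all_order all_algebra.
From mathcomp Require Import zify ring.
Require Import Defs.

Set Implicit Arguments.
Unset Strict Implicit.
Unset Printing Implicit Defensive.

Import GRing.Theory.
Local Open Scope ring_scope.

(** * Laws without terms of negative weight *)

Section Support.
Variables (k : fieldType) (alpha : nat -> nat -> k).

(** Only weights >= 0 occur. The single index of [I12] excluded here is (6, 12); s has no upper
    bound, so that laws extended to s = 13 qualify too. *)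
Definition filtered_law := forall i s, (s <= 2 * i)%N -> alpha i s = 0.

Hypothesis alphaF : filtered_law.

(** Every term of the sum has the same weight r - i - j, whatever l is. *)
Lemma law_coef_eq0 i j r : (i < j)%N -> (r < i + j)%N -> law_coef alpha i j r = 0.
Proof.
move=> ij rij; rewrite /law_coef big_nat big1 // => l /andP[_ hl].
by rewrite alphaF ?mulr0 //; lia.
Qed.

Lemma struct_const_eq0 i j r :
  (0 < i)%N -> (0 < j)%N -> (r < i + j)%N -> struct_const alpha i j r = 0.
Proof.
move=> i0 j0 rij; rewrite /struct_const /struct_const_lt.
case: ltngtP => // ij; last rewrite -(oppr0 k); last congr (- _).
  case: eqP => [i1|_]; last exact: law_coef_eq0.
  by case: eqP => //; lia.
case: eqP => [i1|_]; last by apply: law_coef_eq0; lia.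
by case: eqP => //; lia.
Qed.

End Support.

Lemma struct_constC (k : fieldType) (alpha : nat -> nat -> k) i j r :
  struct_const alpha i j r = - struct_const alpha j i r.
Proof. by rewrite /struct_const; case: ltngtP; rewrite ?opprK ?oppr0. Qed.

Lemma struct_constii (k : fieldType) (alpha : nat -> nat -> k) i r :
  struct_const alpha i i r = 0.
Proof. by rewrite /struct_const ltnn. Qed.

(** * Coordinates in a basis indexed from 1 *)

Section Coordinates.
Variables (k : fieldType) (g : vectType k) (e : nat -> g).
Hypothesis eB : basis_of fullv [seq e i | i <- iota 1 12].

Definition etuple := map_tuple e (iota_tuple 12 1).
(** Outside 1..12 this is the coordinate on [e 1], the default of [inord]; hence the range
    hypotheses on r below. *)
Definition co (r : nat) (x : g) : k := coord etuple (inord r.-1) x.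

Lemma co_linear r a x y : co r (a *: x + y) = a * co r x + co r y.
Proof. by rewrite /co linearP. Qed.

Lemma co_sum r (F : nat -> g) m n :
  co r (\sum_(m <= i < n) F i) = \sum_(m <= i < n) co r (F i).
Proof. by rewrite /co linear_sum. Qed.

Lemma coZ r a x : co r (a *: x) = a * co r x.
Proof. by rewrite /co linearZ. Qed.

Lemma coD r x y : co r (x + y) = co r x + co r y.
Proof. by rewrite /co linearD. Qed.

Lemma co0 r : co r 0 = 0.
Proof. by rewrite /co linear0. Qed.

Lemma nth_etuple (i : 'I_12) : etuple`_i = e i.+1.
Proof. by rewrite (nth_map 0%N) ?nth_iota // size_iota. Qed.

Lemma co_e i r : (0 < i <= 12)%N -> (0 < r <= 12)%N -> co r (e i) = (i == r)%:R.
Proof.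
move=> hi hr; have li : (i.-1 < 12)%N by lia.
have -> : e i = etuple`_(Ordinal li) by rewrite nth_etuple /= prednK //; case/andP: hi.
rewrite /co coord_free ?(basis_free eB) //.
rewrite -val_eqE /= inordK; last by lia.
by have -> : (i.-1 == r.-1) = (i == r) by apply/eqP/eqP; lia.
Qed.

Lemma sum_co x : x = \sum_(1 <= r < 13) co r x *: e r.
Proof.
rewrite big_add1 big_mkord {1}(coord_basis eB (memvf x)).
apply: eq_bigr => i _; rewrite nth_etuple /co.
by congr (coord _ _ _ *: _); apply: val_inj; rewrite /= inordK.
Qed.

Lemma co_inj x y : (forall r, (0 < r <= 12)%N -> co r x = co r y) -> x = y.
Proof.
move=> xy; rewrite (sum_co x) (sum_co y); apply: eq_big_nat => r hr.
by rewrite xy.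
Qed.

Lemma co_lin (a : nat -> k) r : (0 < r <= 12)%N ->
  co r (\sum_(1 <= i < 13) a i *: e i) = a r.
Proof.
move=> hr; rewrite co_sum (bigD1_seq r) ?iota_uniq //=; last first.
  by rewrite mem_index_iota; lia.
rewrite coZ co_e // eqxx mulr1 big_nat_cond big1 ?addr0 // => i hi.
rewrite coZ co_e; [|lia|lia]; case: eqP hi; first by lia.
by rewrite mulr0.
Qed.

End Coordinates.

(** * Symbolic evaluation of structure constants *)

Section FormalPolynomials.
Variables (k : fieldType) (alpha : nat -> nat -> k).

(* Polynomials in the alpha i s, as lists of (coefficient, monomial), on which
   Jacobi expressions with concrete indices can be evaluated by vm_compute. *)
Definition fpoly := seq (int * seq (nat * nat)).

Definition feval (p : fpoly) : k :=
  \sum_(t <- p) t.1%:~R * \prod_(m <- t.2) alpha m.1 m.2.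

Definition fopp (p : fpoly) : fpoly := [seq (- t.1, t.2) | t <- p].

Definition fmul (p q : fpoly) : fpoly :=
  [seq (t.1 * u.1, t.2 ++ u.2) | t <- p, u <- q].

Definition flaw (i j r : nat) : fpoly :=
  [seq ((if odd l then - 'C(j - i - l - 1, l)%:Z else 'C(j - i - l - 1, l)%:Z),
        [:: (i + l, r + i + 2 * l + 1 - j)%N])
  | l <- iota 0 ((j - i - 1)./2).+1 & (2 * (i + l) < r + i + 2 * l + 1 - j)%N].

Definition fstruct_lt (i j r : nat) : fpoly :=
  if i == 1%N then if r == j.+1 then [:: (1, [::])] else [::] else flaw i j r.

Definition fstruct (i j r : nat) : fpoly :=
  if (i < j)%N then fstruct_lt i j r
  else if (j < i)%N then fopp (fstruct_lt j i r) else [::].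

Lemma feval_cat p q : feval (p ++ q) = feval p + feval q.
Proof. exact: big_cat. Qed.

Lemma feval_opp p : feval (fopp p) = - feval p.
Proof.
by rewrite /feval big_map -sumrN; apply: eq_bigr => t _; rewrite mulrNz mulNr.
Qed.

Lemma feval_mul p q : feval (fmul p q) = feval p * feval q.
Proof.
rewrite /feval big_allpairs_dep mulr_suml; apply: eq_bigr => t _.
rewrite mulr_sumr; apply: eq_bigr => u _.
by rewrite big_cat intrM mulrACA.
Qed.

Lemma feval_flatten (I : Type) (s : seq I) (F : I -> fpoly) :
  feval (flatten [seq F i | i <- s]) = \sum_(i <- s) feval (F i).
Proof.
elim: s => [|i s IHs] /=; first by rewrite /feval !big_nil.
by rewrite feval_cat big_cons IHs.
Qed.

Hypothesis alphaF : filtered_law alpha.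

Lemma feval_law i j r : feval (flaw i j r) = law_coef alpha i j r.
Proof.
rewrite /feval /law_coef big_map big_filter /index_iota subn0 [LHS]big_mkcond /=.
apply: eq_bigr => l _; case: ltnP => [_|/alphaF ->]; last by rewrite mulr0.
rewrite big_cons big_nil mulr1 -signr_odd.
by case: (odd l); rewrite ?expr1 ?expr0 ?mulN1r ?mul1r //= mulrNz.
Qed.

Lemma feval_struct i j r : feval (fstruct i j r) = struct_const alpha i j r.
Proof.
have E a b : feval (fstruct_lt a b r) = struct_const_lt alpha a b r.
  rewrite /fstruct_lt /struct_const_lt; case: eqP => _; last exact: feval_law.
  by case: eqP => _; rewrite /feval ?big_cons !big_nil ?addr0 ?mulr1.
rewrite /fstruct /struct_const; case: ltngtP => _; rewrite ?feval_opp ?E //.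
by rewrite /feval big_nil.
Qed.

End FormalPolynomials.

(** The e_r-coefficient of the cyclic sum of [[e_i, e_j], e_l]. Stopping at s = 12 is right for r =
    13 too, since e_13 is central in the extension. *)
Definition jacobi_coef (k : fieldType) (alpha : nat -> nat -> k) i j l r : k :=
  \sum_(1 <= s < 13)
    (struct_const alpha i j s * struct_const alpha s l r
     + struct_const alpha j l s * struct_const alpha s i r
     + struct_const alpha l i s * struct_const alpha s j r).

Definition fjacobi (i j l r : nat) : fpoly :=
  flatten [seq fmul (fstruct i j s) (fstruct s l r)
               ++ fmul (fstruct j l s) (fstruct s i r)
               ++ fmul (fstruct l i s) (fstruct s j r) | s <- iota 1 12].

Lemma feval_jacobi (k : fieldType) (alpha : nat -> nat -> k) i j l r :
  filtered_law alpha ->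
  jacobi_coef alpha i j l r = feval alpha (fjacobi i j l r).
Proof.
move=> aF; rewrite feval_flatten; apply: eq_bigr => s _.
by rewrite !feval_cat !feval_mul !feval_struct // addrA.
Qed.

(** * Brackets and filtration in an adapted basis *)

Section Brackets.
Variables (k : fieldType) (g : vectType k) (br : {bilinear g -> g -> g}).

Lemma mem_lie_prodv (U W : {vspace g}) u w :
  u \in U -> w \in W -> br u w \in lie_prodv br U W.
Proof.
move=> /coord_vbasis -> /coord_vbasis ->.
rewrite linear_sumlz rpred_sum // => i _; rewrite linear_sumr rpred_sum // => j _.
rewrite linearZl_LR linearZr_LR !rpredZ // memv_span //.
by apply: allpairs_f; rewrite mem_nth // size_tuple.
Qed.

Lemma lie_prodv_sub (U W V : {vspace g}) :
  (forall u w, u \in U -> w \in W -> br u w \in V) ->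
  (lie_prodv br U W <= V)%VS.
Proof.
move=> UWV; apply/span_subvP => _ /allpairsP[[u w] [/= uU wW ->]].
by apply: UWV; apply: vbasis_mem.
Qed.

End Brackets.

Section AdaptedBasis.
Variables (k : fieldType) (g : vectType k) (br : {bilinear g -> g -> g}).
Variables (alpha : nat -> nat -> k) (e : nat -> g).
Hypotheses (brL : is_lie_bracket br) (eA : adapted_basis alpha br e).

Let eB : basis_of fullv [seq e i | i <- iota 1 12]. Proof. by case: eA. Qed.

Local Notation c := (struct_const alpha).
Local Notation x_ := (co e).

Lemma brC x y : br x y = - br y x.
Proof.
case: brL => xx _; apply/eqP; rewrite -addr_eq0; apply/eqP.
have := xx (x + y); rewrite linearDl !linearDr /= !xx add0r addr0.
by rewrite addrC.
Qed.

Lemma br_e i j : (0 < i <= 12)%N -> (0 < j <= 12)%N ->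
  br (e i) (e j) = \sum_(1 <= r < 13) c i j r *: e r.
Proof.
have lt_br a b : (0 < a)%N -> (a < b <= 12)%N ->
    br (e a) (e b) = \sum_(1 <= r < 13) struct_const_lt alpha a b r *: e r.
  case: eA => _ b1 b12 b2 a0 /andP[ab b_12].
  rewrite /struct_const_lt; case: eqP => [->|a1]; last by apply: b2 => //; lia.
  apply: (co_inj eB) => r hr; rewrite co_lin //.
  (* For a = 1, b = 12 the formula points at e_13, which is out of range, in agreement with
     [e_1, e_12] = 0. *)
  have [->|bn] := eqVneq b 12%N; first by rewrite b12 co0; case: eqP => //; lia.
  by rewrite b1 ?co_e // 1?eq_sym //; lia.
move=> hi hj; rewrite /struct_const; case: ltngtP => ij.
- by apply: lt_br => //; lia.
- rewrite brC lt_br; [|lia|lia]; rewrite -sumrN.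
  by apply: eq_bigr => r _; rewrite scaleNr.
- by rewrite ij (proj1 brL) big1 // => r _; rewrite scale0r.
Qed.

Lemma co_br_e i j r : (0 < i <= 12)%N -> (0 < j <= 12)%N -> (0 < r <= 12)%N ->
  x_ r (br (e i) (e j)) = c i j r.
Proof. by move=> hi hj hr; rewrite br_e // co_lin. Qed.

Lemma co_br x y r : (0 < r <= 12)%N ->
  x_ r (br x y) = \sum_(1 <= i < 13) \sum_(1 <= j < 13) x_ i x * x_ j y * c i j r.
Proof.
move=> hr; rewrite {1}(sum_co eB x) {1}(sum_co eB y) linear_sumlz co_sum.
apply: eq_big_nat => i hi; rewrite linear_sumr co_sum.
apply: eq_big_nat => j hj.
by rewrite linearZl_LR linearZr_LR !coZ co_br_e // mulrA.
Qed.

Lemma jacobi_coef0 i j l r : (0 < i <= 12)%N -> (0 < j <= 12)%N ->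
  (0 < l <= 12)%N -> (0 < r <= 12)%N -> jacobi_coef alpha i j l r = 0.
Proof.
move=> hi hj hl hr; case: (brL) => _ /(_ (e l) (e i) (e j)).
move=> /(congr1 (x_ r)); rewrite co0 !coD.
have E a b d : (0 < a <= 12)%N -> (0 < b <= 12)%N -> (0 < d <= 12)%N ->
    x_ r (br (e d) (br (e a) (e b))) = - \sum_(1 <= s < 13) c a b s * c s d r.
  move=> ha hb hd; rewrite brC -scaleN1r coZ mulN1r (br_e ha hb) linear_sumlz.
  rewrite co_sum; congr (- _); apply: eq_big_nat => s hs.
  by rewrite linearZl_LR coZ co_br_e.
rewrite !E // => /eqP; rewrite -!opprD oppr_eq0 -!big_split => /eqP H.
by rewrite -[RHS]H.
Qed.

Definition filtration m := <<[seq e i | i <- iota m (13 - m)]>>%VS.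

Lemma mem_filtration m x :
  (forall r, (0 < r < m)%N -> x_ r x = 0) -> x \in filtration m.
Proof.
move=> x0; rewrite (sum_co eB x) big_nat rpred_sum // => r hr.
have [rm|mr] := ltnP r m; first by rewrite x0 ?scale0r ?mem0v //; lia.
by rewrite rpredZ // memv_span // map_f // mem_iota; lia.
Qed.

Lemma filtration_co m x r :
  (0 < m)%N -> x \in filtration m -> (0 < r < m)%N -> x_ r x = 0.
Proof.
move=> m0 xF hr.
have /subvP/(_ _ xF) : (filtration m
    <= lker (linfun (coord (etuple e) (inord r.-1) : g -> k^o)))%VS.
  apply/span_subvP => _ /mapP[i hi ->]; rewrite mem_iota in hi.
  rewrite memv_ker lfunE /= -/(x_ r (e i)) (co_e eB); [|lia|lia].
  by case: (i =P r) => [ir|_]; [lia | rewrite eqxx].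
by rewrite memv_ker lfunE => /eqP.
Qed.

Lemma br_filtration m n p u w : (0 < m)%N -> (0 < n)%N -> (p <= 13)%N ->
  (forall i j r, (m <= i <= 12)%N -> (n <= j <= 12)%N -> (0 < r < p)%N ->
     c i j r = 0) ->
  u \in filtration m -> w \in filtration n -> br u w \in filtration p.
Proof.
move=> m0 n0 p13 c0 uF wF; apply: mem_filtration => r hr.
rewrite co_br; last by lia.
rewrite big_nat big1 // => i hi; rewrite big_nat big1 // => j hj.
have [im|mi] := ltnP i m; first by rewrite (filtration_co m0 uF) ?mul0r //; lia.
have [jn|nj] := ltnP j n.
  by rewrite (filtration_co n0 wF) ?mulr0 ?mul0r //; lia.
by rewrite c0 ?mulr0 //; lia.
Qed.

(** Bracketing e_2 repeatedly with e_1 produces e_i, each bracket going down one step of the lower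
    central series. *)
Lemma e_lcs j i : (j + 2 <= i <= 12)%N -> e i \in lcs br j.
Proof.
elim: j i => [|j IHj] i hi /=; first exact: memvf.
have -> : e i = - br (e i.-1) (e 1%N).
  by rewrite -brC; case: eA => _ b1 _ _; rewrite b1 ?prednK //; lia.
by rewrite rpredN mem_lie_prodv ?memvf // IHj //; lia.
Qed.

Lemma filtration_lcs j : (filtration (j + 2) <= lcs br j)%VS.
Proof.
apply/span_subvP => _ /mapP[i hi ->]; rewrite mem_iota in hi.
by apply: e_lcs; lia.
Qed.

End AdaptedBasis.

(** * The algebra of a law and the conditions (a), (b), (c) *)

Section Laws.
Variables (k : fieldType) (alpha : nat -> nat -> k).

Local Notation c := (struct_const alpha).

Definition std_basis (i : nat) : 'rV[k]_12 := delta_mx 0 (inord i.-1).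

Lemma law_bracket_std i j : (0 < i <= 12)%N -> (0 < j <= 12)%N ->
  law_bracket alpha (std_basis i) (std_basis j)
    = \sum_(1 <= r < 13) c i j r *: std_basis r.
Proof.
move=> hi hj; apply/rowP => r; rewrite big_add1 big_mkord summxE.
have hi' : (i.-1 < 12)%N by lia.
have hj' : (j.-1 < 12)%N by lia.
transitivity (c i j r.+1); last first.
  rewrite (bigD1 r) //= big1 ?addr0 => [|s sr]; rewrite !mxE /= inord_val.
    by rewrite eqxx mulr1.
  by rewrite [r == s]eq_sym (negPf sr) mulr0.
rewrite mxE (bigD1 (inord i.-1)) //= [X in _ + X]big1 => [|a ha]; last first.
  by rewrite big1 // => b _; rewrite !mxE (negPf ha) andbF !mul0r.
rewrite addr0 (bigD1 (inord j.-1)) //= big1 => [|b hb]; last first.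
  by rewrite !mxE (negPf hb) andbF mulr0 mul0r.
rewrite addr0 !mxE !eqxx !mul1r !inordK //.
by have [-> ->] : i.-1.+1 = i /\ j.-1.+1 = j by lia.
Qed.

(** The conditions of [A12_2] bear on this model algebra, so the tools for adapted bases are needed
    for it as well as for g. *)
Lemma law_bracket_adapted : adapted_basis alpha (law_bracket alpha) std_basis.
Proof.
split.
- rewrite basisEdim size_map size_iota dimvf dim_matrix andbT.
  apply/subvP => x _; rewrite (row_sum_delta x) rpred_sum // => i _.
  rewrite rpredZ // memv_span //; apply/mapP; exists i.+1.
    by rewrite mem_iota; case: i => i /= hi; lia.
  by rewrite /std_basis /= inord_val.
- move=> i hi; rewrite [LHS]law_bracket_std //; last by lia.
  rewrite (bigD1_seq i.+1) ?iota_uniq ?mem_index_iota /=; [|lia|by []].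
  rewrite /struct_const /struct_const_lt /= eqxx.
  have -> : (1 < i)%N by lia.
  rewrite scale1r big1 ?addr0 // => s /negPf ->; exact: scale0r.
- rewrite [LHS]law_bracket_std // big_nat big1 // => r hr.
  by rewrite /struct_const /struct_const_lt /=; case: eqP => [|_]; [lia | exact: scale0r].
- move=> i j i2 ij j12; rewrite [LHS]law_bracket_std; [|lia|lia].
  apply: eq_bigr => r _; rewrite /struct_const ij /struct_const_lt ifF //.
  by apply/eqP; lia.
Qed.

End Laws.

Lemma dim_filtration (k : fieldType) (g : vectType k) (e : nat -> g) :
  basis_of fullv [seq e i | i <- iota 1 12] -> \dim (filtration e 2) = 11%N.
Proof.
move=> /basis_free; rewrite -[iota 1 12]/([:: 1%N] ++ iota 2 11) map_cat.
by move=> /catr_free /eqP ->.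
Qed.

Lemma A12_2_alpha (k : fieldType) (alpha : nat -> nat -> k) : A12_2 alpha ->
  [/\ filtered_law alpha, alpha 2 5 != 0 & alpha 3 7 != 0].
Proof.
case=> [[alpha0 brL] pa pb pc].
have eA := law_bracket_adapted alpha; case: (eA) => eB _ _ _.
set e := std_basis k in eA eB.
have c1 i : struct_const alpha i i.+1 (2 * i + 1) = alpha i (2 * i + 1)%N \/ i = 1%N.
  rewrite /struct_const ltnSn /struct_const_lt; case: eqP; first by right.
  left; rewrite /law_coef subSn // subnn /= big_nat1 expr0 bin0 !mul1r addn0.
  by congr alpha; lia.
have aF : filtered_law alpha.
  (* By (b) the elements e_6 and e_7 of g^4 commute, and alpha_{6,12} is the e_12-coordinate of
     their bracket. *)
  have a612 : alpha 6 12 = 0.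
    have e6 := @e_lcs _ _ _ _ _ brL eA 4 6 isT.
    have e7 := @e_lcs _ _ _ _ _ brL eA 4 7 isT.
    have := co_br_e brL eA (i := 6) (j := 7) (r := 12) isT isT isT.
    rewrite (pb _ _ e6 e7) co0 /struct_const /struct_const_lt /law_coef /=.
    by rewrite big_nat1 expr0 !mul1r.
  move=> i s si; have [/andP[/eqP -> /eqP ->] //|n612] := boolP ((i == 6) && (s == 12))%N.
  by apply: alpha0; rewrite /I12 xpair_eqE (negPf n612) orbF; lia.
have lcs1 : (lcs (law_bracket alpha) 1 <= filtration e 3)%VS.
  apply: lie_prodv_sub => u w _ _.
  apply: (br_filtration brL eA (m := 1) (n := 1)) => //.
  - move=> i j r hi hj hr; have [rij|ijr] := ltnP r (i + j).
      by rewrite struct_const_eq0 //; lia.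
    by have [-> ->] : i = 1%N /\ j = 1%N by [split; lia]; rewrite struct_constii.
  - by apply: (mem_filtration eA) => r; lia.
  - by apply: (mem_filtration eA) => r; lia.
split=> //.
(* If alpha_{2,5} = 0, the span of e_2, ..., e_12 contradicts (a): only [e_2, e_3] could leave the
   span of e_6, ..., e_12. *)
- apply/eqP => a25; apply: pa; exists (filtration e 2); split.
  + by rewrite (dim_filtration eB) dimvf dim_matrix.
  + apply: subv_trans lcs1 _; apply/span_subvP => _ /mapP[i hi ->].
    by rewrite memv_span // map_f // mem_iota; rewrite mem_iota in hi; lia.
  + apply: lie_prodv_sub => u w uF /(subvP lcs1) wF.
    apply: (subvP (filtration_lcs brL eA 4)).
    apply: (br_filtration brL eA _ _ _ _ uF wF) => // i j r hi hj hr.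
    have [rij|ijr] := ltnP r (i + j); first by rewrite struct_const_eq0 //; lia.
    have [-> [-> ->]] : i = 2%N /\ j = 3%N /\ r = 5%N by lia.
    by case: (c1 2%N) => // ->.
(* If alpha_{3,7} = 0, the brackets of e_3, ..., e_12 lie in the span of e_8, ..., e_12, hence in
   g^6, and (c) would hold. *)
- apply/eqP => a37; apply: pc.
  apply: lie_prodv_sub => u w /(subvP lcs1) uF /(subvP lcs1) wF.
  apply: (subvP (filtration_lcs brL eA 6)).
  apply: (br_filtration brL eA _ _ _ _ uF wF) => // i j r hi hj hr.
  have [rij|ijr] := ltnP r (i + j); first by rewrite struct_const_eq0 //; lia.
  have c347 : struct_const alpha 3 4 7 = 0 by case: (c1 3%N) => // ->.
  have [->|ij] := eqVneq i j; first exact: struct_constii.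
  have [[-> ->]|[-> ->]] : (i = 3 /\ j = 4) \/ (i = 4 /\ j = 3) by lia.
    by have -> : r = 7%N by lia.
  by rewrite struct_constC; have -> : r = 7%N by [lia]; rewrite c347 oppr0.
Qed.

(** * Consequences of the Jacobi identity in weights 0 and 1 *)

Ltac jacobi_eq aF :=
  rewrite (feval_jacobi _ _ _ _ aF);
  match goal with |- context [fjacobi ?i ?j ?l ?r] =>
    let p := eval vm_compute in (fjacobi i j l r) in
    change (fjacobi i j l r) with p
  end;
  rewrite /feval !big_cons !big_nil /=.

Ltac jacobi_eq_in H aF :=
  rewrite (feval_jacobi _ _ _ _ aF) in H;
  match type of H with context [fjacobi ?i ?j ?l ?r] =>
    let p := eval vm_compute in (fjacobi i j l r) in
    change (fjacobi i j l r) with p in H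
  end;
  rewrite /feval !big_cons !big_nil /= in H.

(** Linear certificates: [etrans] with [comb1] or [comb2] leaves to [ring] or [field] the identity
    expressing a goal through known equations. *)
Lemma comb1 (R : pzRingType) (c x : R) : x = 0 -> c * x = 0.
Proof. by move=> ->; rewrite mulr0. Qed.

Lemma comb2 (R : pzRingType) (c d x y : R) :
  x = 0 -> y = 0 -> c * x + d * y = 0.
Proof. by move=> -> ->; rewrite !mulr0 addr0. Qed.

Section Jacobi.
Variables (k : fieldType) (alpha : nat -> nat -> k).
Hypotheses (char0 : [pchar k] =i pred0) (aF : filtered_law alpha).
Hypothesis J0 : forall i j l r, (0 < i <= 12)%N -> (0 < j <= 12)%N ->
  (0 < l <= 12)%N -> (0 < r <= 12)%N -> jacobi_coef alpha i j l r = 0.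
Hypotheses (a25 : alpha 2 5 != 0) (a37 : alpha 3 7 != 0).

Let natk_neq0 n : (n.+1%:R : k) != 0.
Proof. by have /pcharf0P -> := char0. Qed.

(** The triples (2, 3, 4), (2, 3, 6), (3, 4, 5) give homogeneous quadratic equations in a, x, y, z;
    eliminating y and z leaves x^4 (a - 10 x) = 0. *)
Lemma leading_coefs : exists2 t : k, t != 0 &
  [/\ alpha 2 5 = 4620%:R * t, alpha 3 7 = 462%:R * t, alpha 4 9 = 66%:R * t
    & alpha 5 11 = 11%:R * t].
Proof.
have := @J0 2 3 4 9 isT isT isT isT; jacobi_eq aF.
have := @J0 2 3 6 11 isT isT isT isT; jacobi_eq aF.
have := @J0 3 4 5 12 isT isT isT isT; jacobi_eq aF.
have a0 := a25; have x0 := a37; move: a0 x0.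
set a := alpha 2 5; set x := alpha 3 7; set y := alpha 4 9; set z := alpha 5 11.
move=> a0 x0 e3 e2 e1.
have h1 : y * (2%:R * a + x) - 3%:R * x * x = 0.
  by apply: etrans (comb1 (-1) e1); ring.
have h2 : z * (2%:R * a - x - y) - y * (4%:R * x - 6%:R * y) = 0.
  by apply: etrans (comb2 1 (-1) e2 e1); ring.
have h3 : 3%:R * z * (x + y) - 4%:R * y * y = 0.
  by apply: etrans (comb1 (-1) e3); ring.
(* If 2 a + x were 0, [h1] would read 3 x^2 = 0. *)
have u0 : 2%:R * a + x != 0.
  apply: contraNneq x0 => u0; move: h1; rewrite u0 mulr0 sub0r => /eqP.
  by rewrite oppr_eq0 !mulf_eq0 (negPf (natk_neq0 2)) orbb.
have yE : y = 3%:R * x * x / (2%:R * a + x).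
  by apply: (canRL (mulfK u0)); apply/eqP; rewrite -subr_eq0 h1.
have g3 : 6%:R * x * (z * (a + 2%:R * x) * (2%:R * a + x) - 6%:R * x ^+ 3) = 0.
  apply: etrans (comb1 ((2%:R * a + x) ^+ 2) h3); rewrite yE; field.
  exact: u0.
have {}g3 : z * (a + 2%:R * x) * (2%:R * a + x) - 6%:R * x ^+ 3 = 0.
  by apply/eqP; move/eqP: g3; rewrite !mulf_eq0 (negPf x0) (negPf (natk_neq0 5)).
have g2 : 4%:R * z * (a ^+ 2 - x ^+ 2) * (2%:R * a + x)
          - 6%:R * x ^+ 3 * (4%:R * a - 7%:R * x) = 0.
  apply: etrans (comb1 ((2%:R * a + x) ^+ 2) h2); rewrite yE; field.
  exact: u0.
have aE : a = 10%:R * x.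
  apply/eqP; rewrite -subr_eq0.
  have /eqP : 6%:R * x ^+ 4 * (a - 10%:R * x) = 0.
    (* The multipliers are chosen to cancel z between [g3] and [g2]. *)
    apply: etrans (comb2 (4%:R * (a ^+ 2 - x ^+ 2)) (- (a + 2%:R * x)) g3 g2).
    by ring.
  by rewrite !mulf_eq0 (negPf x0) (negPf (natk_neq0 5)).
have n462 := natk_neq0 461; have n7 := natk_neq0 6.
have n21 := natk_neq0 20; have n132 := natk_neq0 131.
have y7 : y = x / 7%:R.
  have u21 : 2%:R * a + x = 21%:R * x by rewrite aE; ring.
  by rewrite yE u21; field; rewrite n7 x0 n21.
have zE : z = x / 42%:R.
  have n42 := natk_neq0 41.
  have /eqP : (132%:R * x) * (z - x / 42%:R) = 0.
    apply: etrans (comb1 7%:R h2); rewrite y7 aE; field.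
    by rewrite n42 n7.
  by rewrite !mulf_eq0 (negPf x0) (negPf n132) /= subr_eq0 => /eqP.
have n42 := natk_neq0 41.
(* 462 is the least common multiple of 7, 42 and 231; the last one is for the next Witt value x /
   231 = 2 t, to be used at (6, 13). *)
exists (x / 462%:R); first by rewrite mulf_neq0 // invr_eq0.
by split; rewrite ?aE ?y7 ?zE; field; rewrite ?n42 ?n462 ?n7.
Qed.

(** A Jacobi expression of weight 1 pairs constants of weight 0 with constants of weight 1, so it is
    linear in the latter and has a factor t. *)
Lemma first_order_coefs :
  147%:R * alpha 4 10 - 46%:R * alpha 3 8 + 3%:R * alpha 2 6 = 0 /\
  792%:R * alpha 5 12 - 1000%:R * alpha 4 10 - 15%:R * alpha 2 6
    + 250%:R * alpha 3 8 = 0.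
Proof.
have [t t0 [aE xE yE zE]] := leading_coefs.
have := @J0 2 3 4 10 isT isT isT isT; jacobi_eq aF.
have := @J0 2 3 6 12 isT isT isT isT; jacobi_eq aF.
rewrite aE xE yE zE => e2 e1; split; apply/eqP.
  have /eqP : 66%:R * t * (147%:R * alpha 4 10 - 46%:R * alpha 3 8
                             + 3%:R * alpha 2 6) = 0.
    by apply: etrans (comb1 (-1) e1); ring.
  by rewrite !mulf_eq0 (negPf t0) (negPf (natk_neq0 65)).
have /eqP : 11%:R * t * (792%:R * alpha 5 12 - 1000%:R * alpha 4 10
                           - 15%:R * alpha 2 6 + 250%:R * alpha 3 8) = 0.
  by apply: etrans (comb1 1 e2); ring.
by rewrite !mulf_eq0 (negPf t0) (negPf (natk_neq0 10)).
Qed.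

End Jacobi.

(** * Reduction of the Jacobi identity at e_13 to eleven triples *)

Lemma jacobi_coef_rot (k : fieldType) (alpha : nat -> nat -> k) i j l r :
  jacobi_coef alpha i j l r = jacobi_coef alpha j l i r.
Proof. by apply: eq_bigr => s _; rewrite -addrA addrC. Qed.

Lemma jacobi_coef_swap (k : fieldType) (alpha : nat -> nat -> k) i j l r :
  jacobi_coef alpha i j l r = - jacobi_coef alpha j i l r.
Proof.
rewrite -sumrN; apply: eq_bigr => s _.
rewrite (struct_constC _ j i) (struct_constC _ i l) (struct_constC _ l j).
by ring.
Qed.

Lemma jacobi_coef_diag (k : fieldType) (alpha : nat -> nat -> k) i l r :
  jacobi_coef alpha i i l r = 0.
Proof.
apply: big1 => s _; rewrite struct_constii (struct_constC _ i l).
by ring.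
Qed.

Lemma jacobi_coef_eq0 (k : fieldType) (alpha : nat -> nat -> k) i j l r :
  filtered_law alpha -> (0 < i)%N -> (0 < j)%N -> (0 < l)%N ->
  (r < i + j + l)%N -> jacobi_coef alpha i j l r = 0.
Proof.
move=> aF i0 j0 l0 hr.
have E a b d s : (0 < a)%N -> (0 < b)%N -> (0 < d)%N -> (0 < s)%N ->
    (r < a + b + d)%N -> struct_const alpha a b s * struct_const alpha s d r = 0.
  move=> a0 b0 d0 s0 hr'; have [sab|abs] := ltnP s (a + b).
    by rewrite struct_const_eq0 // mul0r.
  by rewrite [X in _ * X]struct_const_eq0 ?mulr0 //; lia.
by rewrite /jacobi_coef big_nat big1 // => s /andP[s0 _]; rewrite !E ?addr0 //; lia.
Qed.

(** The Jacobi expression is alternating in its three lower indices. *)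
Lemma jacobi_coef_sorted (k : fieldType) (alpha : nat -> nat -> k) r :
  (forall i j l, (0 < i)%N -> (i < j)%N -> (j < l)%N ->
     jacobi_coef alpha i j l r = 0) ->
  forall i j l, (0 < i)%N -> (0 < j)%N -> (0 < l)%N ->
     jacobi_coef alpha i j l r = 0.
Proof.
move=> J0 i j l; wlog ij : i j l / (i < j)%N => [H i0 j0 l0|].
  case: (ltngtP i j) => [ij|ji|->]; last exact: jacobi_coef_diag.
    exact: H.
  by rewrite jacobi_coef_swap H ?oppr0.
move=> i0 j0 l0; case: (ltngtP j l) => [jl|lj|<-]; first exact: J0.
  case: (ltngtP i l) => [il|li|<-].
  - by rewrite jacobi_coef_rot jacobi_coef_swap -jacobi_coef_rot J0 ?oppr0.
  - by rewrite -jacobi_coef_rot J0.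
  - by rewrite -jacobi_coef_rot jacobi_coef_diag.
by rewrite jacobi_coef_rot jacobi_coef_diag.
Qed.

(* ad e_1 is a derivation by Pascal's rule, whatever the alpha i s are. *)
Lemma jacobi_coef_ad1 (k : fieldType) (alpha : nat -> nat -> k) :
  filtered_law alpha -> forall j l, (1 < j)%N -> (j < l)%N ->
  (1 + j + l <= 13)%N -> jacobi_coef alpha 1 j l 13 = 0.
Proof.
move=> aF j l; case: j => [|[|[|[|[|[|j]]]]]] //; last by lia.
all: case: l => [|[|[|[|[|[|[|[|[|[|[|l]]]]]]]]]]] //; try lia.
all: by move=> _ _ _; jacobi_eq aF; ring.
Qed.

(** Triples of sum above 13 vanish by weight and those containing 1 by [jacobi_coef_ad1]; exactly
    these eleven increasing triples remain. *)
Lemma jacobi_coef_top (k : fieldType) (alpha : nat -> nat -> k) :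
  filtered_law alpha ->
  jacobi_coef alpha 2 3 4 13 = 0 ->
  jacobi_coef alpha 2 3 5 13 = 0 ->
  jacobi_coef alpha 2 3 6 13 = 0 ->
  jacobi_coef alpha 2 3 7 13 = 0 ->
  jacobi_coef alpha 2 3 8 13 = 0 ->
  jacobi_coef alpha 2 4 5 13 = 0 ->
  jacobi_coef alpha 2 4 6 13 = 0 ->
  jacobi_coef alpha 2 4 7 13 = 0 ->
  jacobi_coef alpha 2 5 6 13 = 0 ->
  jacobi_coef alpha 3 4 5 13 = 0 ->
  jacobi_coef alpha 3 4 6 13 = 0 ->
  forall i j l, (0 < i)%N -> (0 < j)%N -> (0 < l)%N ->
    jacobi_coef alpha i j l 13 = 0.
Proof.
move=> aF J234 J235 J236 J237 J238 J245 J246 J247 J256 J345 J346.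
apply: jacobi_coef_sorted => i j l i0 ij jl.
have [ijl|hs] := ltnP 13 (i + j + l); first by apply: jacobi_coef_eq0 => //; lia.
case: i i0 ij hs => [|[|[|[|i]]]] // _ ij hs; last by lia.
- exact: jacobi_coef_ad1.
- case: j ij jl hs => [|[|[|[|[|[|j]]]]]] //;
    by [lia | case: l => [|[|[|[|[|[|[|[|[|l]]]]]]]]] // _ _ hs; lia].
- case: j ij jl hs => [|[|[|[|[|[|j]]]]]] //;
    by [lia | case: l => [|[|[|[|[|[|[|l]]]]]]] // _ _ hs; lia].
Qed.

(* The law of a one-dimensional central extension by e_13, with (6, 13), (5, 13)
   and (4, 13) as the additional indices; alpha 2 13 and alpha 3 13 only change
   the cocycle by another cocycle and are set to 0. *)
Definition extend_law (k : fieldType) (alpha : nat -> nat -> k) (b4 b5 b6 : k)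
    (i s : nat) : k :=
  if s == 13 then nth 0 [:: 0; 0; 0; 0; b4; b5; b6] i else alpha i s.

(** * Extension of the law to dimension 13 *)

Section Extension.
Variables (k : fieldType) (alpha : nat -> nat -> k).
Hypothesis aF : filtered_law alpha.

Lemma extend_filtered b4 b5 b6 : filtered_law (extend_law alpha b4 b5 b6).
Proof.
move=> i s si; rewrite /extend_law; case: eqP => [s13|_]; last exact: aF.
by rewrite nth_default //=; lia.
Qed.

(** Since 2 l <= j - i - 1, the second index of alpha in [law_coef] is at most r, so 13 does not
    occur. *)
Lemma struct_const_extend b4 b5 b6 i j r : (0 < i)%N -> (0 < j)%N ->
  (r < 13)%N ->
  struct_const (extend_law alpha b4 b5 b6) i j r = struct_const alpha i j r.
Proof.
move=> i0 j0 r13.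
have E a b : (a < b)%N ->
    struct_const_lt (extend_law alpha b4 b5 b6) a b r = struct_const_lt alpha a b r.
  move=> ab; rewrite /struct_const_lt; case: eqP => // _.
  apply: eq_big_nat => l hl; rewrite /extend_law ifF //.
  by apply/eqP; lia.
by rewrite /struct_const; case: ltngtP => // ij; rewrite E.
Qed.

Hypothesis char0 : [pchar k] =i pred0.
Hypothesis J0 : forall i j l r, (0 < i <= 12)%N -> (0 < j <= 12)%N ->
  (0 < l <= 12)%N -> (0 < r <= 12)%N -> jacobi_coef alpha i j l r = 0.
Hypotheses (a25 : alpha 2 5 != 0) (a37 : alpha 3 7 != 0).

Let natk_neq0 n : (n.+1%:R : k) != 0.
Proof. by have /pcharf0P -> := char0. Qed.

(** These are Witt values: for i >= 2 the constant is 27720 t (13 - 2 i) (i - 2)! (11 - i)! / 11!,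
    nonzero since 13 is odd. The constants b4 and b5 have positive weight and do not enter. *)
Lemma extend_antidiag_lt7 t b4 b5 i : t != 0 ->
  alpha 2 5 = 4620%:R * t -> alpha 3 7 = 462%:R * t ->
  alpha 4 9 = 66%:R * t -> alpha 5 11 = 11%:R * t -> (0 < i < 7)%N ->
  struct_const (extend_law alpha b4 b5 (2%:R * t)) i (13 - i) 13 != 0.
Proof.
move=> t0 aE xE yE zE.
have bF := extend_filtered b4 b5 (2%:R * t).
case: i => [|[|[|[|[|[|[|i]]]]]]] // _; rewrite -(feval_struct bF);
  match goal with |- context [fstruct ?i ?j ?r] =>
    let p := eval vm_compute in (fstruct i j r) in
    change (fstruct i j r) with p
  end;
  rewrite /feval !big_cons !big_nil /extend_law /= ?aE ?xE ?yE ?zE.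
- by rewrite !mulr1 addr0 oner_neq0.
- by rewrite (_ : _ + _ = 2268%:R * t) ?mulf_neq0 //; ring.
- by rewrite (_ : _ + _ = 196%:R * t) ?mulf_neq0 //; ring.
- by rewrite (_ : _ + _ = 35%:R * t) ?mulf_neq0 //; ring.
- by rewrite (_ : _ + _ = 9%:R * t) ?mulf_neq0 //; ring.
- by rewrite (_ : _ + _ = 2%:R * t) ?mulf_neq0 //; ring.
Qed.

Lemma extend_antidiag b4 b5 b6 :
  (forall i, (0 < i < 7)%N ->
     struct_const (extend_law alpha b4 b5 b6) i (13 - i) 13 != 0) ->
  forall i, (0 < i <= 12)%N ->
    struct_const (extend_law alpha b4 b5 b6) i (13 - i) 13 != 0.
Proof.
move=> lt7 i hi; have [i7|i7] := ltnP i 7; first by apply: lt7; lia.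
rewrite struct_constC oppr_eq0; have {2}-> : i = (13 - (13 - i))%N by lia.
by apply: lt7; lia.
Qed.

(** The choice b6 = 2 t prolongs the Witt pattern; b5 and b4, of weights 2 and 4, are fitted to (2,
    3, 6) and (2, 3, 4). The nine other equations then follow. *)
Lemma extension_exists : exists b4 b5 b6,
  (forall i j l, (0 < i)%N -> (0 < j)%N -> (0 < l)%N ->
     jacobi_coef (extend_law alpha b4 b5 b6) i j l 13 = 0) /\
  (forall i, (0 < i <= 12)%N ->
     struct_const (extend_law alpha b4 b5 b6) i (13 - i) 13 != 0).
Proof.
have [t t0 [aE xE yE zE]] := leading_coefs char0 aF J0 a25 a37.
have [W1 W2] := first_order_coefs char0 aF J0 a25 a37.
have := @J0 2 3 4 11 isT isT isT isT; jacobi_eq aF.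
have := @J0 2 3 4 12 isT isT isT isT; jacobi_eq aF.
rewrite aE xE yE zE => W4 W3.
(* The Jacobi expressions of (2, 3, 6) and (2, 3, 4) at e_13 are affine in b5 and
   in b4, with slopes 88 * 99 t and - 98 * 99 t. *)
pose b5 := - jacobi_coef (extend_law alpha 0 0 (2%:R * t)) 2 3 6 13
             / (88%:R * 99%:R * t).
pose b4 := jacobi_coef (extend_law alpha 0 b5 (2%:R * t)) 2 3 4 13
             / (98%:R * 99%:R * t).
have b5E : jacobi_coef (extend_law alpha 0 0 (2%:R * t)) 2 3 6 13
             + 88%:R * 99%:R * t * b5 = 0.
  by rewrite [_ * b5]mulrC divfK ?addrN // !mulf_neq0.
have b4E : jacobi_coef (extend_law alpha 0 b5 (2%:R * t)) 2 3 4 13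
             - 98%:R * 99%:R * t * b4 = 0.
  by rewrite [_ * b4]mulrC divfK ?addrN // !mulf_neq0.
(* Only the defining equations of b5 and b4 are kept, so that no division reaches [ring]. *)
move: (b5) (b4) b5E b4E => {b5 b4} b5 b4 b5E b4E.
jacobi_eq_in b4E (extend_filtered 0 b5 (2%:R * t)).
jacobi_eq_in b5E (extend_filtered 0 0 (2%:R * t)).
rewrite /extend_law /= aE xE yE zE in b4E b5E.
exists b4, b5, (2%:R * t).
have bF := extend_filtered b4 b5 (2%:R * t).
split; last first.
  apply: extend_antidiag => i.
  exact: (extend_antidiag_lt7 b4 b5 t0 aE xE yE zE).
(* By the weight 13 - i - j - l: weight 0 holds identically, weight 1 follows from [W1] and [W2],
   weight 2 from [W3] and the choice of b5, weight 3 from [W4], weight 4 from the choice of b4. *)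
apply: (jacobi_coef_top bF); jacobi_eq bF;
  rewrite /extend_law /= ?aE ?xE ?yE ?zE.
- by apply: etrans (comb1 1 b4E); ring.
- by apply: etrans (comb1 1 W4); ring.
- by apply: etrans (comb1 1 b5E); ring.
- by apply: etrans (comb2 (56%:R * t) (20%:R * t) W1 W2); ring.
- by ring.
- by apply: etrans (comb2 1 (-1) W3 b5E); ring.
- by apply: etrans (comb2 (- (56%:R * t)) (- (9%:R * t)) W1 W2); ring.
- by ring.
- by ring.
- by apply: etrans (comb2 (- (10%:R * t)) (- (2%:R * t)) W1 W2); ring.
- by ring.
Qed.

End Extension.

(** * The cocycle as a symplectic form *)

Section Cocycle.
Variables (k : fieldType) (g : vectType k) (e : nat -> g).
Variable beta : nat -> nat -> k.

Definition cocycle (x y : g) : k :=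
  \sum_(1 <= i < 13) \sum_(1 <= j < 13)
    co e i x * co e j y * struct_const beta i j 13.

(** Here [idfun] is the field automorphism expected of a sesquilinear form; it allows the form to be
    declared skew-symmetric below. *)
Lemma cocycle_is_bilinear :
  bilinear_for
    (GRing.Scale.Law.clone _ _ ( *%R : k -> k -> k) _)
    (GRing.Scale.Law.clone _ _ (idfun \; *%R : k -> k -> k) _) cocycle.
Proof.
split=> [y | x] a u v; rewrite /= mulr_sumr -big_split /=;
  apply: eq_bigr => i _; rewrite mulr_sumr -big_split /=;
  apply: eq_bigr => j _; rewrite co_linear; ring.
Qed.

HB.instance Definition _ :=
  bilinear_isBilinear.Build k g g k *%R (idfun \; *%R) cocycle cocycle_is_bilinear.

Lemma cocycle_is_skew x y : cocycle x y = (-1) ^+ true * idfun (cocycle y x).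
Proof.
rewrite /= expr1 mulN1r /cocycle exchange_big /= -sumrN.
apply: eq_bigr => i _; rewrite -sumrN; apply: eq_bigr => j _.
by rewrite struct_constC; ring.
Qed.

HB.instance Definition _ :=
  isHermitianSesquilinear.Build k g true idfun cocycle cocycle_is_skew.

End Cocycle.

Section Symplectic.
Variables (k : fieldType) (g : vectType k) (br : {bilinear g -> g -> g}).
Variables (alpha : nat -> nat -> k) (e : nat -> g) (b4 b5 b6 : k).
Hypotheses (brL : is_lie_bracket br) (eA : adapted_basis alpha br e).
Hypothesis aF : filtered_law alpha.

Let eB : basis_of fullv [seq e i | i <- iota 1 12]. Proof. by case: eA. Qed.

Local Notation beta := (extend_law alpha b4 b5 b6).
Local Notation w := (cocycle e beta).

(** Stated for a bare function with explicit linearity, so that a trilinear expression can be tested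
    one argument at a time. *)
Lemma eq0_on_basis (f : g -> k) :
  (forall a x y, f (a *: x + y) = a * f x + f y) ->
  (forall i, (0 < i <= 12)%N -> f (e i) = 0) -> forall x, f x = 0.
Proof.
move=> fL f0 x; rewrite (sum_co eB x) big_nat.
have f00 : f 0 = 0.
  by have := fL (-1) 0 0; rewrite scaler0 addr0 mulN1r addNr.
apply: (big_ind (fun y => f y = 0)) => // [y z y0 z0|i hi].
  by rewrite -[y]scale1r fL y0 z0 mulr0 addr0.
by rewrite -[_ *: _]addr0 fL f0 // f00 mulr0 addr0.
Qed.

Lemma cocycle_e i x : (0 < i <= 12)%N ->
  w (e i) x = \sum_(1 <= j < 13) co e j x * struct_const beta i j 13.
Proof.
move=> hi; rewrite /cocycle (bigD1_seq i) ?iota_uniq ?mem_index_iota //=.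
rewrite [X in _ + X]big_nat_cond [X in _ + X]big1 => [|j /andP[hj ji]].
  by rewrite addr0; apply: eq_bigr => j _; rewrite co_e // eqxx mul1r.
by apply: big1 => l _; rewrite co_e // eq_sym (negPf ji) !mul0r.
Qed.

Lemma cocycle_ee i j : (0 < i <= 12)%N -> (0 < j <= 12)%N ->
  w (e i) (e j) = struct_const beta i j 13.
Proof.
move=> hi hj; rewrite cocycle_e // (bigD1_seq j) ?iota_uniq ?mem_index_iota //=.
rewrite [X in _ + X]big_nat_cond [X in _ + X]big1 => [|l /andP[hl lj]].
  by rewrite addr0 co_e // eqxx mul1r.
by rewrite co_e // eq_sym (negPf lj) !mul0r.
Qed.

Lemma cocycle_br i j l : (0 < i <= 12)%N -> (0 < j <= 12)%N -> (0 < l <= 12)%N ->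
  w (br (e i) (e j)) (e l)
    = \sum_(1 <= s < 13) struct_const beta i j s * struct_const beta s l 13.
Proof.
move=> hi hj hl; rewrite (br_e brL eA hi hj) linear_sumlz.
apply: eq_big_nat => s hs; rewrite linearZl_LR /= cocycle_ee //.
by rewrite [X in _ = X * _]struct_const_extend; [|lia|lia|lia].
Qed.

(** On basis vectors, closedness is the e_13-coefficient of the Jacobi identity of the extended
    law. *)
Lemma cocycle_closed :
  (forall i j l, (0 < i)%N -> (0 < j)%N -> (0 < l)%N ->
     jacobi_coef beta i j l 13 = 0) ->
  forall x y z, w (br x y) z - w (br x z) y + w (br y z) x = 0.
Proof.
move=> J0 x y z; move: x; apply: eq0_on_basis => [a x x'|i hi].
  rewrite !(linearPl, linearPr) /=; ring.
move: y; apply: eq0_on_basis => [a y y'|j hj].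
  rewrite !(linearPl, linearPr) /=; ring.
move: z; apply: eq0_on_basis => [a z z'|l hl].
  rewrite !(linearPl, linearPr) /=; ring.
rewrite !cocycle_br // -[RHS](J0 i j l); [|lia|lia|lia].
rewrite /jacobi_coef -sumrN -!big_split /=; apply: eq_bigr => s _.
by rewrite (struct_constC _ l i); ring.
Qed.

(** The Gram matrix is antitriangular: pairing x with e_{13-r} involves only the coordinates of x up
    to r. For x in the radical they vanish one after the other. *)
Lemma cocycle_nondegenerate :
  (forall i, (0 < i <= 12)%N -> struct_const beta i (13 - i) 13 != 0) ->
  nondegenerate w.
Proof.
move=> w0; rewrite /nondegenerate -subv0; apply/subvP => x /mem_orthovP xw.
rewrite memv0; apply/eqP/(co_inj eB) => r; rewrite co0.
elim/ltn_ind: r => r IHr hr; apply/eqP.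
have /eqP : w (e (13 - r)%N) x = 0.
  by rewrite cocycle_is_skew xw ?memvf //= mulr0.
rewrite cocycle_e; last by lia.
rewrite (bigD1_seq r) ?iota_uniq ?mem_index_iota //=.
rewrite [X in _ + X]big_nat_cond [X in _ + X]big1 => [|j /andP[hj jr]].
  by rewrite addr0 mulf_eq0 struct_constC oppr_eq0 (negPf (w0 r hr)) orbF.
have [lt_jr|le_rj] := ltnP j r; first by rewrite IHr ?mul0r.
rewrite struct_const_eq0 ?mulr0 //; try lia.
exact: extend_filtered.
Qed.

End Symplectic.

(** * Derivations *)

Section Derivation.
Variables (k : fieldType) (g : vectType k) (br : {bilinear g -> g -> g}).
Variables (alpha : nat -> nat -> k) (e : nat -> g).
Hypotheses (brL : is_lie_bracket br) (eA : adapted_basis alpha br e).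
Hypothesis aF : filtered_law alpha.
Variable D : {linear g -> g}.
Hypothesis DD : derivation br D.

Let eB : basis_of fullv [seq e i | i <- iota 1 12]. Proof. by case: eA. Qed.

Local Notation c := (struct_const alpha).
Local Notation d i r := (co e r (D (e i))).

Lemma co_derivation x r :
  co e r (D x) = \sum_(1 <= i < 13) co e i x * d i r.
Proof.
rewrite {1}(sum_co eB x) linear_sum co_sum; apply: eq_bigr => i _.
by rewrite linearZ coZ.
Qed.

Lemma derivation_coef i j r :
  (0 < i <= 12)%N -> (0 < j <= 12)%N -> (0 < r <= 12)%N ->
  \sum_(1 <= s < 13) c i j s * d s r =
  \sum_(1 <= s < 13) d i s * c s j r + \sum_(1 <= s < 13) d j s * c i s r.
Proof.
move=> hi hj hr; transitivity (co e r (D (br (e i) (e j)))).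
  by rewrite co_derivation; apply: eq_big_nat => s hs; rewrite (co_br_e brL eA).
rewrite DD coD; congr (_ + _).
  rewrite {1}(sum_co eB (D (e i))) linear_sumlz co_sum.
  by apply: eq_big_nat => s hs; rewrite linearZl_LR coZ (co_br_e brL eA).
rewrite {1}(sum_co eB (D (e j))) linear_sumr co_sum.
by apply: eq_big_nat => s hs; rewrite linearZr_LR coZ (co_br_e brL eA).
Qed.

Lemma struct_const1 i r : (1 < i)%N -> c 1 i r = (r == i.+1)%:R.
Proof. by move=> i1; rewrite /struct_const i1. Qed.

(** This is D e_{i+1} = [D e_1, e_i] + [e_1, D e_i]. The first bracket is split at s = 1; the second
    is a shift by one, without e_2 because [e_1, e_1] = 0. *)
Lemma derivation_step i r : (1 < i < 12)%N -> (0 < r <= 12)%N ->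
  d i.+1 r = d 1 1 * (r == i.+1)%:R + \sum_(2 <= s < 13) d 1 s * c s i r
             + (if (2 < r)%N then d i r.-1 else 0).
Proof.
move=> hi hr; have i1 : (1 < i)%N by lia.
have := @derivation_coef 1 i r isT; rewrite hr => /(_ _ isT) H.
have {H} := H ltac:(lia).
rewrite (bigD1_seq i.+1) ?iota_uniq ?mem_index_iota /=; [|lia|by []].
rewrite struct_const1 // eqxx mul1r big1 ?addr0 => [->|s /negPf si]; last first.
  by rewrite struct_const1 // si mul0r.
rewrite big_ltn // struct_const1 //; congr (_ + _).
rewrite big_ltn // struct_constii mulr0 add0r.
case: ifP => r2.
  rewrite (bigD1_seq r.-1) ?iota_uniq ?mem_index_iota /=; [|lia|by []].
  rewrite struct_const1 ?prednK; [|lia|lia].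
  rewrite eqxx mulr1 big_nat_cond big1 ?addr0 // => s /andP[hs sr].
  rewrite struct_const1; last by lia.
  by case: eqP => [rs|_]; [lia | rewrite mulr0].
rewrite big_nat big1 // => s hs; rewrite struct_const1; last by lia.
by case: eqP => [rs|_]; [lia | rewrite mulr0].
Qed.

Lemma derivation_sum0 i r m : (0 < i)%N -> (r < m + i)%N -> (0 < m)%N ->
  \sum_(m <= s < 13) d 1 s * c s i r = 0.
Proof.
move=> i0 rmi m0; rewrite big_nat big1 // => s hs.
by rewrite struct_const_eq0 ?mulr0 //; lia.
Qed.

(** A possible e_1-component of D e_2 is killed by ad e_1, so D respects the filtration from e_3 on;
    [d 2 1] is left to [derivation_e2]. *)
Lemma derivation_lower i r :
  (2 < i <= 12)%N -> (0 < r < i)%N -> d i r = 0.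
Proof.
elim: i r => // i IHi r hi hr; rewrite derivation_step; [|lia|lia].
rewrite derivation_sum0 ?addr0; [|lia|lia|lia].
have -> : (r == i.+1) = false by apply/eqP; lia.
rewrite mulr0 add0r; case: ifP => // r2; apply: IHi; lia.
Qed.

Lemma derivation_diag i : (i <= 10)%N -> d i.+2 i.+2 = d 2 2 + i%:R * d 1 1.
Proof.
elim: i => [|i IHi] hi; first by rewrite mul0r addr0.
rewrite derivation_step; [|lia|lia].
rewrite eqxx derivation_sum0 ?addr0 //= ?IHi -?natr1; [by ring|lia..].
Qed.

Lemma derivation_subdiag i : (1 < i <= 10)%N ->
  d i.+1 i.+2 = d 1 2 * c 2 i i.+2 + d i i.+1.
Proof.
move=> hi; rewrite derivation_step; [|lia|lia].
rewrite big_ltn // derivation_sum0 /= ?addr0; [|lia|lia|lia].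
have -> : (i.+2 == i.+1) = false by apply/eqP; lia.
by rewrite mulr0 add0r ifT //; lia.
Qed.

(** Each application of D clears one more leading coordinate, so twelve suffice. *)
Lemma strictly_lower_nilpotent :
  (forall i r, (0 < r <= i)%N -> (i <= 12)%N -> d i r = 0) -> nilpotent_map D.
Proof.
move=> d0; exists 12%N => x; apply: (co_inj eB) => r; rewrite co0.
have : forall m r, (0 < r <= 12)%N -> (r <= m)%N -> co e r (iter m D x) = 0.
  elim=> [|m IHm] {}r hr hm; first by lia.
  rewrite /= co_derivation big_nat big1 // => i hi.
  have [ir|ri] := ltnP i r; first by rewrite IHm ?mul0r //; lia.
  by rewrite d0 ?mulr0 //; lia.
by move=> H hr; apply: H => //; case/andP: hr.
Qed.

Ltac struct_eval :=
  repeat match goal with |- context [struct_const alpha ?i ?j ?r] =>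
    rewrite -(feval_struct aF i j r);
    let p := eval vm_compute in (fstruct i j r) in
    change (fstruct i j r) with p
  end;
  rewrite /feval !big_cons !big_nil /=.

Ltac derivation_eq i j r :=
  have /eqP := @derivation_coef i j r isT isT isT;
  rewrite -subr_eq0 => /eqP; rewrite /index_iota unlock /=;
  repeat match goal with |- context [co e ?r (_ (e ?i))] =>
    rewrite (@derivation_lower i r isT isT) end;
  struct_eval.

(** In D [e_2, e_3], the coefficient of e_4 gives [d 2 1]; that of e_5, after division by
    alpha_{2,5}, compares the weights of e_2 and e_1. *)
Lemma derivation_e2 : alpha 2 5 != 0 -> d 2 1 = 0 /\ d 2 2 = 2%:R * d 1 1.
Proof.
move=> a0; have d21 : d 2 1 = 0.
  derivation_eq 2%N 3%N 4%N => E.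
  by apply: etrans (comb1 (-1) E); ring.
split=> //; have := @derivation_diag 3 isT; have := @derivation_diag 1 isT.
derivation_eq 2%N 3%N 5%N; rewrite d21 => E d33 d55.
rewrite d33 d55 in E; apply/eqP; rewrite -subr_eq0.
have /eqP : alpha 2 5 * (d 2 2 - 2%:R * d 1 1) = 0.
  by apply: etrans (comb1 (-1) E); ring.
by rewrite mulf_eq0 (negPf a0).
Qed.

(** The entry [d 2 3] must cancel, since ad e_1 is a derivation with [d 2 3] = 1 and [d 1 1] =
    [d 1 2] = 0. *)
Lemma derivation_first_order : alpha 2 5 != 0 ->
  alpha 2 6 * d 1 1 + 2%:R * alpha 2 5 ^+ 2 * d 1 2 = 0 /\
  alpha 3 8 * d 1 1 + 3%:R * alpha 3 7 * (alpha 2 5 - alpha 3 7) * d 1 2 = 0.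
Proof.
move=> a0; have [d21 d22] := derivation_e2 a0.
have d33 := @derivation_diag 1 isT; have d44 := @derivation_diag 2 isT.
have d66 := @derivation_diag 4 isT;
have d88 := @derivation_diag 6 isT.
have c224 : c 2 2 4 = 0 := struct_constii _ _ _.
have c235 : c 2 3 5 = alpha 2 5 by struct_eval; ring.
have c246 : c 2 4 6 = alpha 2 5 by struct_eval; ring.
have c257 : c 2 5 7 = alpha 2 5 - alpha 3 7 by struct_eval; ring.
have c268 : c 2 6 8 = alpha 2 5 - 2%:R * alpha 3 7 by struct_eval; ring.
have d34 := @derivation_subdiag 2 isT; have d45 := @derivation_subdiag 3 isT.
have d56 := @derivation_subdiag 4 isT; have d67 := @derivation_subdiag 5 isT.
have d78 := @derivation_subdiag 6 isT.
split.
  derivation_eq 2%N 3%N 6%N => E.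
  rewrite d66 d56 d33 d45 d34 c224 c235 c246 d22 in E.
  by apply: etrans (comb1 1 E); ring.
derivation_eq 3%N 4%N 8%N => E.
rewrite d78 d67 d56 d88 d33 d44 d45 d34 c224 c235 c246 c257 c268 d22 in E.
by apply: etrans (comb1 1 E); ring.
Qed.

Lemma derivation_nilpotent : [pchar k] =i pred0 -> alpha 2 5 != 0 ->
  alpha 2 5 = 10%:R * alpha 3 7 ->
  200%:R * alpha 3 8 - 27%:R * alpha 2 6 != 0 -> nilpotent_map D.
Proof.
move=> char0 a0 aE h.
have [d21 d22] := derivation_e2 a0; have [E1 E2] := derivation_first_order a0.
have d11 : d 1 1 = 0.
  have /eqP : (200%:R * alpha 3 8 - 27%:R * alpha 2 6) * d 1 1 = 0.
    (* With x = alpha_{3,7}, the coefficients of [d 1 2] become 200 x^2 and 27 x^2; eliminating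
       [d 1 2] produces the expression in [h]. *)
    rewrite aE in E1 E2.
    by apply: etrans (comb2 (- 27%:R) 200%:R E1 E2); ring.
  by rewrite mulf_eq0 (negPf h) => /eqP.
apply: strictly_lower_nilpotent => i r hr hi.
have [ri|ir] := ltnP r i.
  have [i2|i2] := ltnP 2 i; first by apply: derivation_lower; lia.
  by have [-> ->] : i = 2%N /\ r = 1%N by lia.
have -> : r = i by lia.
case: i hi {ir} hr => [|[|i]] hi hr; [lia | exact: d11|].
by rewrite derivation_diag // d22 d11 !mulr0 addr0.
Qed.

End Derivation.

Theorem corollary4p4 (k : fieldType) (g : vectType k)
    (br : {bilinear g -> g -> g}) (alpha : nat -> nat -> k) (e : nat -> g) :
  [pchar k] =i pred0 ->
  is_lie_bracket br ->
  \dim {:g} = 12%N ->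
  filiform br ->
  A12_2 alpha ->
  adapted_basis alpha br e ->
  200%:R * alpha 3%N 8%N - 27%:R * alpha 2%N 6%N != 0 ->
  symplectic br /\ characteristically_nilpotent br.
Proof.
move=> char0 brL _ _ /A12_2_alpha [aF a25 a37] eA h.
have J0 := jacobi_coef0 brL eA.
split.
  have [b4 [b5 [b6 [Jtop w0]]]] := extension_exists aF char0 J0 a25 a37.
  exists (cocycle e (extend_law alpha b4 b5 b6)).
    exact: (cocycle_nondegenerate eA aF w0).
  exact: (cocycle_closed brL eA Jtop).
move=> D DD; apply: (derivation_nilpotent brL eA aF DD char0 a25 _ h).
have [t _ [-> -> _ _]] := leading_coefs char0 aF J0 a25 a37.
by ring.
Qed.
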